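(* Let $G$ be a $(k,d,\lambda,\mu)$-strongly regular graph, and let $K$ be the corresponding CRG: $K$ has vertex set $V(G)$, all vertices black, with an edge of $K$ gray if its endpoints are adjacent in $G$ and white if they are nonadjacent in $G$. Then for all $p\in[0,1]$, $$f_K(p)=\frac1k+\left(\frac{k-d-2}{k}\right)p.$$ If $t$ is an integer with $\lambda\leq t-3$ and $\mu\leq t-1$, then $K$ forbids $K_{2,t}$ embedding (there is no colored homomorphism from $K_{2,t}$ to $K$); and if $\lambda=t-3$ and $\mu=t-1$, then $$f_K(p)=\frac{t-1}{t-1+d(d+1)}+\left(1-\frac{(d+2)(t-1)}{t-1+d(d+1)}\right)p.$$
   Context: A $(k,d,\lambda,\mu)$-strongly regular graph is a graph on $k$ vertices in which every vertex has degree $d$, each pair of adjacent vertices has exactly $\lambda$ common neighbors and each pair of distinct nonadjacent vertices has exactly $\mu$ common neighbors (with $\lambda,\mu$ nonnegative integers). A colored regularity graph (CRG) $K$ is a finite complete graph with each vertex colored black or white and each edge colored black, white or gray. For a CRG $K$ on $k$ vertices, with $\mathrm{VW},\mathrm{VB},\mathrm{EW},\mathrm{EB}$ its sets of white vertices, black vertices, white edges and black edges, $$f_K(p)=\frac{1}{k^2}\left[p\left(|\mathrm{VW}|+2|\mathrm{EW}|\right)+(1-p)\left(|\mathrm{VB}|+2|\mathrm{EB}|\right)\right].$$ A colored homomorphism (embedding) from a simple graph $H$ to a CRG $K$ is a map $\phi:V(H)\to V(K)$ such that for distinct $u,v\in V(H)$: if $uv\in E(H)$, then either $\phi(u)=\phi(v)$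 is a black vertex, or $\phi(u)\ne\phi(v)$ and the edge $\phi(u)\phi(v)$ is black or gray; if $uv\notin E(H)$, then either $\phi(u)=\phi(v)$ is a white vertex, or $\phi(u)\neq\phi(v)$ and the edge $\phi(u)\phi(v)$ is white or gray. $K_{2,t}$ is the complete bipartite graph with parts of sizes $2$ and $t$. *)

(* Defs.v *)
From HB Require Import structures.
From mathcomp Require Import all_boot all_order all_algebra.

Set Implicit Arguments.
Unset Strict Implicit.
Unset Printing Implicit Defensive.

Import Order.TTheory GRing.Theory Num.Theory.

Local Open Scope ring_scope.

Record sgraph := SGraph {
  svertex :> finType;
  sadj : rel svertex;
  sadj_sym : symmetric sadj;
  sadj_irrefl : irreflexive sadj
}.

Definition neighbors (G : sgraph) (v : G) : {set G} := [set w | sadj v w].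

Definition strongly_regular (G : sgraph) (k d lam mu : nat) : Prop :=
  [/\ #|G| = k,
      forall v : G, #|neighbors v| = d,
      forall u v : G, sadj u v -> #|neighbors u :&: neighbors v| = lam
    & forall u v : G, u != v -> ~~ sadj u v ->
        #|neighbors u :&: neighbors v| = mu].

Definition bip_adj (m n : nat) : rel ('I_m + 'I_n)%type :=
  fun x y => match x, y with
             | inl _, inr _ | inr _, inl _ => true
             | _, _ => false
             end.

Lemma bip_adj_sym m n : symmetric (@bip_adj m n).
Proof. by case=> ? []. Qed.

Lemma bip_adj_irrefl m n : irreflexive (@bip_adj m n).
Proof. by case. Qed.

Definition complete_bipartite (m n : nat) : sgraph :=
  SGraph (@bip_adj_sym m n) (@bip_adj_irrefl m n).

Inductive vcolor := VWhite | VBlack.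
Inductive ecolor := EWhite | EBlack | EGray.

Lemma vcolor_comparable : comparable vcolor.
Proof. by rewrite /comparable /decidable; decide equality. Defined.
HB.instance Definition _ := hasDecEq.Build vcolor (compareP vcolor_comparable).

Lemma ecolor_comparable : comparable ecolor.
Proof. by rewrite /comparable /decidable; decide equality. Defined.
HB.instance Definition _ := hasDecEq.Build ecolor (compareP ecolor_comparable).

(* The edge uv, for u != v, has color [ecol u v]; the diagonal values
   [ecol u u] are meaningless and never used. *)
Record crg := CRG {
  cvertex :> finType;
  vcol : cvertex -> vcolor;
  ecol : cvertex -> cvertex -> ecolor;
  ecol_sym : forall u v, ecol u v = ecol v u
}.

Definition vertices_of_color (K : crg) (c : vcolor) : {set K} :=
  [set v : K | vcol v == c].

(* Edges are unordered pairs, so each edge is counted once. *)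
Definition edges_of_color (K : crg) (c : ecolor) : {set {set K}} :=
  [set [set u; v] | u in K, v in K & (u != v) && (ecol u v == c)].

Definition crg_f (R : realFieldType) (K : crg) (p : R) : R :=
  1 / #|K|%:R ^+ 2 *
    (p * (#|vertices_of_color K VWhite|%:R
          + 2 * #|edges_of_color K EWhite|%:R)
     + (1 - p) * (#|vertices_of_color K VBlack|%:R
                  + 2 * #|edges_of_color K EBlack|%:R)).

Definition colored_hom (H : sgraph) (K : crg) (phi : H -> K) : Prop :=
  forall u v : H, u <> v ->
    (sadj u v ->
       (phi u = phi v /\ vcol (phi u) = VBlack)
       \/ (phi u <> phi v /\
           (ecol (phi u) (phi v) = EBlack \/ ecol (phi u) (phi v) = EGray)))
    /\
    (~~ sadj u v ->
       (phi u = phi v /\ vcol (phi u) = VWhite)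
       \/ (phi u <> phi v /\
           (ecol (phi u) (phi v) = EWhite \/ ecol (phi u) (phi v) = EGray))).

Definition forbids (K : crg) (H : sgraph) : Prop :=
  ~ exists phi : H -> K, colored_hom phi.

Definition graph_ecol (G : sgraph) (u v : G) : ecolor :=
  if sadj u v then EGray else EWhite.

Lemma graph_ecol_sym (G : sgraph) (u v : G) : graph_ecol u v = graph_ecol v u.
Proof. by rewrite /graph_ecol sadj_sym. Qed.

Definition crg_of_graph (G : sgraph) : crg :=
  CRG (fun _ : G => VBlack) (@graph_ecol_sym G).

(* Main.v *)
Require Import Defs.
From mathcomp Require Import all_boot all_order all_algebra.
From mathcomp Require Import zify ring.

(* Any two vertices on the same side of K_{2,t} need distinct images because K
   has no white vertex, so the side of size t maps injectively into the set of
   common closed neighbours of two distinct vertices of G; that set has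
   lam + 2 or mu elements.  The second formula for f_K follows from the first
   by the parameter identity d(d - lam - 1) = mu(k - d - 1): when
   lam + 2 = mu it reads mu k = mu + d(d + 1). *)

Import Order.TTheory GRing.Theory Num.Theory.

Local Open Scope ring_scope.

Lemma eq_set2 (T : finType) (a b u v : T) : a != b ->
  ([set a; b] == [set u; v]) = ((a, b) == (u, v)) || ((a, b) == (v, u)).
Proof.
move=> nab; rewrite !xpair_eqE; apply/eqP/orP; last first.
  by case=> /andP[/eqP-> /eqP->]; rewrite // setUC.
move=> eqS; have := set21 a b; have := set22 a b; rewrite eqS !in_set2.
move=> /orP[] /eqP eb /orP[] /eqP ea; rewrite ea eb !eqxx;
  by [left | right | move: nab; rewrite ea eb eqxx].
Qed.

(** The map [(u, v)] to [{u, v}] is two-to-one onto the edges: since [ecol] is symmetric, the fibre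
    over an edge is exactly [(u, v)] and [(v, u)]. Ordered pairs are easier to count vertex by
    vertex. *)
Lemma card_edges_of_color (K : crg) (c : ecolor) :
  (2 * #|edges_of_color K c|)%N
    = #|[set x : K * K | (x.1 != x.2) && (ecol x.1 x.2 == c)]|.
Proof.
set P := [set x | _]; set f := fun x : K * K => [set x.1; x.2].
have -> : edges_of_color K c = f @: P.
  apply/setP=> e; apply/imset2P/imsetP => [[u v _]|[[u v]]].
    by rewrite inE /= => Puv ->; exists (u, v); rewrite ?inE.
  by rewrite inE /= => Puv ->; exists u v; rewrite ?inE.
rewrite -[RHS]sum1_card (partition_big_imset f) /= mulnC -sum_nat_const.
apply: eq_bigr => _ /imsetP[[u v] Puv ->].
have /andP[nuv cuv] : (u != v) && (ecol u v == c) by move: Puv; rewrite inE.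
rewrite sum1dep_card; transitivity #|[set (u, v); (v, u)]|.
  by rewrite cards2 xpair_eqE negb_and nuv.
apply/esym/eq_card => -[a b]; rewrite !inE /f /=.
apply/andP/idP => [[/andP[nab _]]|]; first by rewrite eq_set2.
case/orP=> /eqP[-> ->]; first by rewrite nuv cuv.
by rewrite eq_sym nuv ecol_sym cuv setUC.
Qed.

Section StronglyRegular.

Variables (G : sgraph) (k d lam mu : nat).
Hypothesis srgG : strongly_regular G k d lam mu.

Lemma srg_card_nonneighbors (v : G) :
  (#|[set w : G | (v != w) && ~~ sadj v w]| + d + 1)%N = k.
Proof.
have [cG deg _ _] := srgG; rewrite -cG -(deg v).
rewrite -(cardsC (v |: neighbors v)) cardsU1 !inE sadj_irrefl /=.
have -> : ~: (v |: neighbors v) = [set w : G | (v != w) && ~~ sadj v w].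
  by apply/setP=> w; rewrite !inE negb_or eq_sym.
lia.
Qed.

(* Count the walks of length two from v according to their middle vertex and
   according to their endpoint. *)
Lemma srg_param_identity : (0 < k)%N ->
  (d * d + mu * (d + 1) = d + d * lam + mu * k)%N.
Proof.
have [cG deg cadj cnadj] := srgG; rewrite -{1}cG => /card_gt0P[v _].
have walks : (d * d = \sum_(w : G) #|neighbors v :&: neighbors w|)%N.
  transitivity (\sum_(u in neighbors v) #|neighbors u|)%N.
    by rewrite (eq_bigr (fun=> d)) // sum_nat_const deg.
  under eq_bigr => u _ do rewrite -sum1_card big_mkcond /=.
  rewrite exchange_big /=; apply: eq_bigr => w _.
  rewrite -sum1_card -big_mkcondr /=; apply: eq_bigl => u.
  by rewrite !inE (sadj_sym w).
(* The endpoint is [v] itself ([d] walks), a neighbour of [v] ([lam] walks each) or another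
   nonneighbour ([mu] walks each). *)
rewrite -(srg_card_nonneighbors v) walks (bigD1 v) //= setIid deg.
rewrite (bigID (fun w => sadj v w)) /=.
rewrite (eq_bigr (fun=> lam)); last by move=> w /andP[_ /cadj].
rewrite [X in (_ + (_ + X) + _)%N](eq_bigr (fun=> mu)); last first.
  by move=> w /andP[nwv]; apply: cnadj; rewrite eq_sym.
rewrite !sum_nat_cond_const.
have -> : #|[set w | (w != v) && sadj v w]| = d.
  rewrite -(deg v); apply: eq_card => w; rewrite !inE.
  by case: eqP => // ->; rewrite sadj_irrefl.
have -> : #|[set w | (w != v) && ~~ sadj v w]|
          = #|[set w : G | (v != w) && ~~ sadj v w]|.
  by apply: eq_card => w; rewrite !inE eq_sym.
nia.
Qed.

(** Each vertex lies on [k - d - 1] white edges, and summing over vertices counts every white edge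
    twice. The additive form avoids truncated subtraction. *)
Lemma srg_card_white_edges :
  (2 * #|edges_of_color (crg_of_graph G) EWhite| + k * (d + 1) = k * k)%N.
Proof.
have [cG _ _ _] := srgG; rewrite card_edges_of_color /=.
set P := [set x | _].
suff -> : #|P| = (k * (k - (d + 1)))%N.
  (* Undoing the subtraction requires [d + 1 <= k], which the existence of a vertex ensures; for
     [k = 0] both sides vanish. *)
  rewrite -mulnDr; case: (posnP k) => [->//|]; rewrite -{1}cG.
  by case/card_gt0P=> v _; have := srg_card_nonneighbors v; nia.
rewrite -sum1_card (partition_big fst predT) //= -{1}cG -sum_nat_const.
apply: eq_bigr => v _; rewrite sum1dep_card.
have -> : [set x | (x \in P) && (x.1 == v)]
    = pair v @: [set w : G | (v != w) && ~~ sadj v w].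
  apply/setP=> -[a b]; apply/idP/imsetP => [|[w]]; rewrite !inE /=.
    case/andP=> /andP[nab cab] /eqP<-; exists b; rewrite // inE nab /=.
    by move: cab; rewrite /graph_ecol; case: ifP.
  case/andP=> nvw avw [-> ->]; rewrite nvw eqxx andbT /=.
  by rewrite /graph_ecol (negbTE avw).
rewrite card_imset; last by move=> a b [].
by have := srg_card_nonneighbors v; lia.
Qed.

(** Only black vertices and white edges carry weight: the bracket is [(1 - p) k + p k (k - d - 1) =
    k + p k (k - d - 2)]. *)
Lemma srg_crg_f (R : realFieldType) (p : R) : (0 < k)%N ->
  crg_f (crg_of_graph G) p = 1 / k%:R + (k%:R - d%:R - 2) / k%:R * p.
Proof.
move=> k_gt0; have [cG _ _ _] := srgG; rewrite /crg_f /= cG.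
have -> : #|vertices_of_color (crg_of_graph G) VWhite| = 0%N.
  by apply: eq_card0 => v; rewrite inE.
have -> : #|vertices_of_color (crg_of_graph G) VBlack| = k.
  by rewrite -cG -cardsT; apply: eq_card => v; rewrite !inE.
have -> : #|edges_of_color (crg_of_graph G) EBlack| = 0%N.
  apply: eq_card0 => e; apply/negP => /imset2P[u v _].
  by rewrite inE /= /graph_ecol; case: sadj; rewrite !andbF.
have /(congr1 (fun n => n%:R : R)) := srg_card_white_edges.
rewrite natrD !natrM natrD => /(canRL (addrK _)) ->.
have k_neq0 : k%:R != 0 :> R by rewrite pnatr_eq0 -lt0n.
by field.
Qed.

(** If [a] and [b] are adjacent, both join their [lam] common neighbours; otherwise neither lies in
    the closed neighbourhood of the other, and only the [mu] common neighbours remain. *)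
Lemma card_common_closed_neighbors (a b : G) : a != b ->
  (#|(a |: neighbors a) :&: (b |: neighbors b)| <= maxn (lam + 2) mu)%N.
Proof.
have [_ _ cadj cnadj] := srgG => nab; rewrite leq_max.
case: (boolP (sadj a b)) => [adj|nadj]; apply/orP; [left|right].
  have sub : (a |: neighbors a) :&: (b |: neighbors b)
      \subset [set a; b] :|: (neighbors a :&: neighbors b).
    apply/subsetP=> w; rewrite !inE.
    by do !case: eqP => //=.
  apply: leq_trans (subset_leq_card sub) _.
  apply: leq_trans (leq_card_setU _ _) _.
  by rewrite cards2 nab cadj // addnC.
rewrite -(cnadj a b) //; apply/subset_leq_card/subsetP=> w; rewrite !inE.
case: (eqVneq w a) => [->|_] /=.
  by rewrite (negbTE nab) sadj_sym (negbTE nadj).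
by case: (eqVneq w b) => [->|//]; rewrite (negbTE nadj).
Qed.

Lemma srg_forbids_K2t (t : nat) : (lam + 3 <= t)%N -> (mu + 1 <= t)%N ->
  forbids (crg_of_graph G) (complete_bipartite 2 t).
Proof.
move=> lam_t mu_t [phi hphi].
have nonadj_neq x y : x <> y -> ~~ @sadj (complete_bipartite 2 t) x y ->
    phi x != phi y.
  by move=> nxy nadj; have [_ /(_ nadj) [[]|[/eqP]]] := hphi x y nxy.
(* Closed neighbourhoods arise because an edge may collapse to one black vertex; if it does not, its
   image is gray, hence an edge of [G]. *)
have adj_in x y : @sadj (complete_bipartite 2 t) x y ->
    phi y \in (phi x : G) |: neighbors (phi x : G).
  move=> adj; have nxy : x <> y by move=> e; rewrite e sadj_irrefl in adj.
  have [/(_ adj) hadj _] := hphi x y nxy.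
  rewrite !inE; case: hadj => [[-> _]|[_]]; first by rewrite eqxx.
  by rewrite /= /graph_ecol; case: ifP => [_|_ []//]; rewrite orbT.
pose a : complete_bipartite 2 t := inl ord0.
pose b : complete_bipartite 2 t := inl ord_max.
have nab : phi a != phi b by apply: nonadj_neq.
pose g (i : 'I_t) : G := phi (inr i).
have g_inj : injective g.
  move=> i j gij; apply/eqP/negPn/negP=> /eqP nij.
  suff : g i != g j by rewrite gij eqxx.
  by apply: nonadj_neq => // -[].
have sub : g @: 'I_t \subset
    ((phi a : G) |: neighbors (phi a : G))
      :&: ((phi b : G) |: neighbors (phi b : G)).
  by apply/subsetP=> _ /imsetP[i _ ->]; rewrite inE !adj_in.
have := leq_trans (subset_leq_card sub) (card_common_closed_neighbors _ _ nab).
rewrite card_imset // card_ord; lia.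
Qed.

End StronglyRegular.

Theorem theorem10 (R : realFieldType) (G : sgraph) (k d lam mu : nat)
    (k_gt0 : (0 < k)%N) (srgG : strongly_regular G k d lam mu) :
  let K := crg_of_graph G in
  [/\ forall p : R, 0 <= p <= 1 ->
        crg_f K p = 1 / k%:R + (k%:R - d%:R - 2) / k%:R * p,
      forall t : nat, (lam + 3 <= t)%N -> (mu + 1 <= t)%N ->
        forbids K (complete_bipartite 2 t)
    & forall t : nat, (lam + 3 = t)%N -> (mu + 1 = t)%N ->
        forall p : R, 0 <= p <= 1 ->
          crg_f K p =
            (t%:R - 1) / (t%:R - 1 + d%:R * (d%:R + 1))
            + (1 - ((d%:R + 2) * (t%:R - 1))
                   / (t%:R - 1 + d%:R * (d%:R + 1))) * p].
Proof.
move=> K; split=> [p _|t|t lam_t mu_t p _]; first by exact: (srg_crg_f _ _ _ _ _ srgG).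
  exact: (srg_forbids_K2t _ _ _ _ _ srgG).
rewrite (srg_crg_f _ _ _ _ _ srgG) //.
have mu_gt0 : (0 < mu)%N by lia.
have /(congr1 (fun n => n%:R : R)) : (mu * k = mu + d * (d + 1))%N.
  have lam_mu : mu = (lam + 2)%N by lia.
  by have := srg_param_identity _ _ _ _ _ srgG k_gt0; rewrite lam_mu; nia.
(* Since [t - 1 = mu], the denominator [t - 1 + d(d + 1)] becomes [mu * k], nonzero because both
   factors are positive. *)
rewrite natrD !natrM natrD -mu_t natrD addrK => <-.
have k_neq0 : k%:R != 0 :> R by rewrite pnatr_eq0 -lt0n.
have mu_neq0 : mu%:R != 0 :> R by rewrite pnatr_eq0 -lt0n.
by field; rewrite k_neq0.
Qed.
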